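(* Let two logically independent events $A$ and $C$ and any coherent probability assessment $(x,y)$ on $\{C,\,C|A\}$ be given (so $P(C)=x$, $P(C|A)=y$). The extension $z=P(A)$ is coherent (i.e. the assessment $(x,y,z)$ on $\{C,\,C|A,\,A\}$ is coherent) if and only if $z'\le z\le z''$, where $$z'=0,\qquad z''=\begin{cases}1, & \text{if } x=y,\\[2pt] \dfrac{x}{y}, & \text{if } x<y,\\[6pt] \dfrac{1-x}{1-y}, & \text{if } x>y.\end{cases}$$
   Context: An event is a two-valued (true/false) logical entity, identified with its $0/1$ indicator; $\Omega$ is the sure event, $AB$ denotes conjunction and $\overline{A}$ negation. The constituents generated by finitely many events are the non-impossible conjunctions obtained by choosing each event or its negation. Events $A_1,\dots,A_n$ are logically independent if they generate $2^n$ constituents. A conditional event $E|H$ ($H\neq\emptyset$) is a three-valued entity which is true, false, or void according to whether $EH$, $\overline{E}H$, or $\overline{H}$ is true; an unconditional event $E$ is identified with $E|\Omega$. Coherence (de Finetti). An assessment $(p_1,\dots,p_n)$ on a finite family $\{E_1|H_1,\dots,E_n|H_n\}$ is coherent if, for every nonempty subset $J\subseteq\{1,\dots,n\}$ and all real numbers $s_i$ ($i\in J$), the random gain $G=\sum_{i\in J}s_iH_i(E_i-p_i)$, restricted to the constituents contained in $\bigvee_{i\in J}H_i$, satisfies $\min G\le 0\le\max G$. Conditional probability is thus a primitive notion; $P(C|A)$ is allowed when $P(A)=0$. *)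

(* Defs.v *)
From HB Require Import structures.
From mathcomp Require Import all_boot all_order all_algebra.
From mathcomp Require Import reals.
Set Implicit Arguments.
Unset Strict Implicit.
Unset Printing Implicit Defensive.
Import Order.TTheory GRing.Theory Num.Theory.

(* Events are the elements of an arbitrary Boolean algebra B:
   \top is the sure event, \bot the impossible event, [A `&` B] conjunction,
   [~` A] negation, and [A <= B] logical implication. *)

Section Constituents.
Local Open Scope order_scope.
Context {d : Order.disp_t} {B : ctbDistrLatticeType d}.
Implicit Types (E A C : B) (Es : seq B).

Fixpoint sign_conjunctions Es : seq B :=
  if Es is E :: Es' then
    [seq l `&` c | l <- [:: E; ~` E], c <- sign_conjunctions Es']
  else [:: \top].

(* No repetitions arise: conjunctions for different choices of signs are
   disjoint, hence distinct once the impossible ones are removed. *)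
Definition constituents Es : seq B :=
  [seq c <- sign_conjunctions Es | c != \bot].

Definition logically_independent Es : Prop :=
  size (constituents Es) = (2 ^ size Es)%N.

Lemma logically_independent_sure A C :
  logically_independent [:: A; C] -> (\top : B) != \bot.
Proof.
move=> indep; apply/eqP => top0; move: indep.
have all0 (c : B) : c = \bot by rewrite -[c]meetx1 top0 meetx0.
by rewrite /logically_independent /constituents -(@eq_filter _ pred0) ?filter_pred0
  // => c /=; rewrite [c]all0 eqxx.
Qed.

Lemma logically_independent_neq0 A C :
  logically_independent [:: A; C] -> A != \bot.
Proof.
move=> indep; apply/eqP => A0; move: indep.
rewrite /logically_independent /constituents A0 /= !meet0x eqxx /=.
by case: ifP; case: ifP.
Qed.

Record cond_event := CondEvent {
  consequent : B;
  antecedent : B;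
  antecedent_neq0 : antecedent != \bot }.

Definition uncond_event (sure : (\top : B) != \bot) E : cond_event :=
  CondEvent E sure.

End Constituents.
Arguments cond_event {d} B.

Section Coherence.
Local Open Scope ring_scope.
Context {d : Order.disp_t} {B : ctbDistrLatticeType d} {R : realType}.

Definition seq_min (v : seq R) : R := \big[Num.min/head 0 v]_(g <- v) g.
Definition seq_max (v : seq R) : R := \big[Num.max/head 0 v]_(g <- v) g.

Section Family.
Variables (n : nat) (F : n.-tuple (cond_event B)) (p : n.-tuple R).

Definition family_constituents : seq B :=
  constituents (map consequent F ++ map antecedent F).

(* Each constituent c decides all the events of the family, so the indicator
   of such an event E takes on c the value [(c <= E)%O]. *)
Definition gain (J : {set 'I_n}) (s : 'I_n -> R) (c : B) : R :=
  \sum_(i in J) s i * (c <= antecedent (tnth F i))%O%:R *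
    ((c <= consequent (tnth F i))%O%:R - tnth p i).

(* Never empty when J is nonempty, since antecedents are possible. *)
Definition gain_values (J : {set 'I_n}) (s : 'I_n -> R) : seq R :=
  [seq gain J s c | c <- family_constituents
    & (c <= \join_(i in J) antecedent (tnth F i))%O].

Definition coherent : Prop :=
  forall (J : {set 'I_n}) (s : 'I_n -> R), J != set0 ->
    seq_min (gain_values J s) <= 0 <= seq_max (gain_values J s).

End Family.
End Coherence.

(* Main.v *)
Require Import Defs.
From HB Require Import structures.
From mathcomp Require Import all_boot all_order all_algebra.
From mathcomp Require Import reals ring lra.
Set Implicit Arguments.
Unset Strict Implicit.
Unset Printing Implicit Defensive.
Import Order.Theory GRing.Theory Num.Theory.
Local Open Scope ring_scope.

(** The constituents decide [A] and [C], so they amount to the four truth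
    assignments of the pair.  A probability mass on them that agrees with
    [(x, y, z)] can only be [y z] on [A C], [(1 - y) z] on [A] and not [C],
    [x - y z] on [C] and not [A], and [1 - x - (1 - y) z] on neither.  Given
    that [0 <= y <= 1], it is nonnegative when [0 <= z], [y z <= x] and
    [(1 - y) z <= 1 - x].  This is the stated interval: [x < y] makes
    [y z <= x] the binding upper bound, [y < x] makes [(1 - y) z <= 1 - x] the
    binding one, and for [x = y] the two add up to [z <= 1].

    A negative mass for a constituent outside [A] would be a negative price for
    a bet on it, hence a sure win; so the last two inequalities are read off
    the gains of suitable bets ([coherent_triple_bounds]), while [0 <= z <= 1]
    comes from bets on [A] alone ([coherent_cond_bounds]).  Conversely the mass
    gives the expectation [0] to every gain, which therefore cannot be positive
    everywhere.  The only bets that the mass might not control are those on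
    [C | A] alone, since [A] may have mass [0]; for them the weights [y] and
    [1 - y] on [C] and its negation given [A] do the same work
    ([bounds_coherent_triple]). *)

(** * Constituents *)

Section Constituents.
Local Open Scope order_scope.
Context {d : Order.disp_t} {B : ctbDistrLatticeType d}.
Implicit Types (E A C c e : B) (Es : seq B).

Lemma constituent_decides Es c E :
  c \in constituents Es -> E \in Es -> (c <= E) || (c <= ~` E).
Proof.
rewrite mem_filter => /andP[_].
elim: Es c => [//|E' Es IH] c /=; rewrite cats0 mem_cat inE.
by case/orP=> /mapP[c' c'Es ->] /predU1P[->|/(IH _ c'Es)/orP[]];
  rewrite ?leIl ?orbT // => /(le_trans (leIr c' _)) ->; rewrite ?orbT.
Qed.

(** Distributing [e] over [E] or not [E] for each event in turn keeps at least
    one possible part: the constituents cover the sure event. *)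
Lemma constituent_meets Es e :
  e != \bot -> exists2 c, c \in constituents Es & e `&` c != \bot.
Proof.
move=> e0; suff [c cEs ec] : exists2 c, c \in sign_conjunctions Es &
    e `&` c != \bot.
  exists c => //; rewrite mem_filter cEs andbT.
  by apply: contraNneq ec => ->; rewrite meetx0.
elim: Es e e0 => [|E Es IH] e e0 /=; first by exists \top; rewrite ?inE ?meetx1.
have [l lE el] : exists2 l, l \in [:: E; ~` E] & e `&` l != \bot.
  have [eE|] := eqVneq (e `&` E) \bot; last by exists E; rewrite ?inE ?eqxx.
  exists (~` E); rewrite ?inE ?eqxx ?orbT //.
  apply: contraNneq e0 => eE'.
  by rewrite -[e]meetx1 -(joinxC E) meetUr eE eE' joinxx.
have [c cEs elc] := IH _ el.
by exists (l `&` c); [apply: (allpairs_f _ lE cEs) | rewrite meetA].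
Qed.

Lemma constituent_le_of_meets Es c e E :
    c \in constituents Es -> E \in Es -> e `&` c != \bot -> e <= E ->
  c <= E.
Proof.
move=> cEs EEs ec eE; have /orP[//|cE'] := constituent_decides cEs EEs.
by move: ec; rewrite -lex0 (le_trans (leI2 eE cE')) // meetxC.
Qed.

Definition literal (b : bool) E := if b then E else ~` E.

Lemma independent_literals_neq0 A C (a b : bool) :
  logically_independent [:: A; C] -> literal a A `&` literal b C != \bot.
Proof.
rewrite /logically_independent /constituents size_filter /= !meetx1.
by case: a; case: b => /=;
  move: (_ != \bot) (_ != \bot) (_ != \bot) (_ != \bot) => [] [] [] [].
Qed.

(** Under logical independence, refining the four conjunctions of [A] and [C]
    by further events leaves no truth assignment out. *)
Lemma constituent_realizes Es A C (a b : bool) :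
    logically_independent [:: A; C] -> A \in Es -> C \in Es ->
  exists2 c, c \in constituents Es & ((c <= A) = a) /\ ((c <= C) = b).
Proof.
move=> indep AEs CEs.
have [c cEs meets] := constituent_meets Es (independent_literals_neq0 a b indep).
have truth E t : E \in Es -> literal a A `&` literal b C <= literal t E ->
    (c <= E) = t.
  case: t => /= EEs le_E.
    exact: constituent_le_of_meets cEs EEs meets le_E.
  apply: contraNF meets => cE.
  by rewrite -lex0 (le_trans (leI2 le_E cE)) // meetC meetxC.
by exists c => //; split; apply: truth; rewrite ?leIl ?leIr.
Qed.

End Constituents.

(** * Coherence through one-sided gains *)

Section Coherence.
Context {d : Order.disp_t} {B : ctbDistrLatticeType d} {R : realType}.

Lemma mem_head_default (v : seq R) : v != [::] -> head 0 v \in v.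
Proof. by case: v => // g v _; apply: mem_head. Qed.

Lemma seq_min_leP (v : seq R) (t : R) : v != [::] ->
  reflect (exists2 g, g \in v & g <= t) (seq_min v <= t).
Proof.
move=> v0; apply: (iffP idP) => [le_t|[g gv]]; last first.
  by apply: le_trans; apply: ge_bigmin_seq.
exists (seq_min v) => //; rewrite /seq_min big_seq.
elim/big_ind: _ => // [|g h gv hv]; first exact: mem_head_default.
by rewrite /Num.min; case: ifP.
Qed.

Lemma seq_max_geP (v : seq R) (t : R) : v != [::] ->
  reflect (exists2 g, g \in v & t <= g) (t <= seq_max v).
Proof.
move=> v0; apply: (iffP idP) => [ge_t|[g gv] tg]; last first.
  by apply: (le_trans tg); apply: le_bigmax_seq.
exists (seq_max v) => //; rewrite /seq_max big_seq.
elim/big_ind: _ => // [|g h gv hv]; first exact: mem_head_default.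
by rewrite /Num.max; case: ifP.
Qed.

(** The point of also asking for [0 < w t] is that a mass concentrated on the
    conditioning event yields a value attained inside that event. *)
Lemma average_le0 (T : finType) (w h : T -> R) :
    (forall t, 0 <= w t) -> 0 < \sum_t w t -> \sum_t w t * h t <= 0 ->
  exists2 t, 0 < w t & h t <= 0.
Proof.
move=> w0 wT avg; case: (pickP [pred t | (0 < w t) && (h t <= 0)]) => [t|none].
  by case/andP; exists t.
have wh0 t : 0 <= w t * h t.
  have := none t; rewrite /= lt0r w0 andbT; case: eqP => [->|_ /=].
    by rewrite mul0r.
  by rewrite leNgt => /negbFE/ltW; apply: mulr_ge0.
have /eqP : \sum_t w t * h t = 0 by apply/le_anti; rewrite avg sumr_ge0.
rewrite psumr_eq0 // => /allP all0; suff wT0 : \sum_t w t = 0.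
  by move: wT; rewrite wT0 ltxx.
apply: big1 => t _; have := all0 t (mem_index_enum t); rewrite mulf_eq0.
have := none t; rewrite /= lt0r w0 andbT; case: eqP => //= _.
by case: ltgtP.
Qed.

Section Family.
Variables (n : nat) (F : n.-tuple (cond_event B)) (p : n.-tuple R).
Implicit Types (J : {set 'I_n}) (s : 'I_n -> R) (c : B).

Lemma mem_family_consequent (i : 'I_n) :
  consequent (tnth F i) \in map consequent F ++ map antecedent F.
Proof. by rewrite mem_cat -tnth_map mem_tnth. Qed.

Lemma mem_family_antecedent (i : 'I_n) :
  antecedent (tnth F i) \in map consequent F ++ map antecedent F.
Proof. by rewrite mem_cat -[antecedent _]tnth_map mem_tnth orbT. Qed.

Lemma gain_values_neq_nil J s : J != set0 -> gain_values F p J s != [::].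
Proof.
case/set0Pn => i iJ.
have [c cF meets] := constituent_meets (map consequent F ++ map antecedent F)
  (antecedent_neq0 (tnth F i)).
have cH := constituent_le_of_meets cF (mem_family_antecedent i) meets (lexx _).
have : gain F p J s c \in gain_values F p J s.
  apply: map_f; rewrite mem_filter cF andbT.
  by apply: le_trans cH _; apply: joins_sup.
by case: gain_values.
Qed.

Lemma gainN J s c : gain F p J (fun i => - s i) c = - gain F p J s c.
Proof. by rewrite /gain -sumrN; apply: eq_bigr => i _; rewrite !mulNr. Qed.

(** Reversing the stakes exchanges the two bounds on a gain, so it is enough
    to ask for one of them. *)
Lemma coherentP :
  coherent F p <->
  forall J s, J != set0 -> exists c,
    [/\ c \in family_constituents F,
        (c <= \join_(i in J) antecedent (tnth F i))%O &
        gain F p J s c <= 0].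
Proof.
split=> [coh J s J0 | loss J s J0].
  have /andP[/(seq_min_leP _ (gain_values_neq_nil s J0))[g /mapP[c]]] := coh J s J0.
  by rewrite mem_filter => /andP[cJ cF] -> gc _; exists c.
have mem_gain s' c : c \in family_constituents F ->
    (c <= \join_(i in J) antecedent (tnth F i))%O ->
    gain F p J s' c \in gain_values F p J s'.
  by move=> cF cJ; apply: map_f; rewrite mem_filter cJ.
apply/andP; split.
  have [c [cF cJ gc]] := loss J s J0.
  apply/seq_min_leP; first exact: gain_values_neq_nil.
  by exists (gain F p J s c); first exact: mem_gain.
have [c [cF cJ gc]] := loss J (fun i => - s i) J0.
apply/seq_max_geP; first exact: gain_values_neq_nil.
by exists (gain F p J s c); [exact: mem_gain | rewrite -oppr_le0 -gainN].
Qed.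

(** A unit stake on the [i]-th conditional event alone, for or against it,
    must not win surely. *)
Lemma coherent_cond_bounds (i : 'I_n) : coherent F p -> 0 <= tnth p i <= 1.
Proof.
have J0 : [set i] != set0 by apply/set0Pn; exists i; rewrite inE.
move/coherentP => coh; apply/andP; split.
  have [c [_]] := coh _ (fun=> 1) J0; rewrite /gain !big_set1 => -> /=.
  by case: (_ <= consequent _)%O => /=; lra.
have [c [_]] := coh _ (fun=> -1) J0; rewrite /gain !big_set1 => -> /=.
by case: (_ <= consequent _)%O => /=; lra.
Qed.

End Family.

(** * Events [C], [C | A] and [A] *)

Section Triple.
Variables (A C : B) (indep : logically_independent [:: A; C]) (x y z : R).

Let evt := uncond_event (logically_independent_sure indep).
Let C_given_A := CondEvent C (logically_independent_neq0 indep).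
Let F := [tuple evt C; C_given_A; evt A].
Let p := [tuple x; y; z].
Let i0 : 'I_3 := @Ordinal 3 0 isT.
Let i1 : 'I_3 := @Ordinal 3 1 isT.
Let i2 : 'I_3 := @Ordinal 3 2 isT.

Let stakes (J : {set 'I_3}) (s : 'I_3 -> R) (i : 'I_3) : R :=
  if i \in J then s i else 0.

Lemma gain_triple (J : {set 'I_3}) (s : 'I_3 -> R) (c : B) :
  gain F p J s c =
    stakes J s i0 * ((c <= C)%O%:R - x) +
    stakes J s i1 * (c <= A)%O%:R * ((c <= C)%O%:R - y) +
    stakes J s i2 * ((c <= A)%O%:R - z).
Proof.
rewrite /gain big_mkcond /= !big_ord_recl big_ord0 addr0 /stakes.
have -> : ord0 = i0 by apply: val_inj.
have -> : lift i0 (ord0 : 'I_2) = i1 by apply: val_inj.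
have -> : lift i0 (lift ord0 (ord0 : 'I_1)) = i2 by apply: val_inj.
rewrite !(tnth_nth (evt C)) !(tnth_nth 0) /= !lex1 /=.
by do 3![case: ifP => _]; ring.
Qed.

(** The stakes [(1, -1, - y)] and [(-1, 1, y - 1)] are bets on the two
    constituents outside [A]: their gains are the indicators of [C] and not
    [A], and of neither, minus [x - y z] and [1 - x - (1 - y) z] respectively.
    If one of these prices were negative, the bet would win surely. *)
Lemma coherent_triple_bounds :
  coherent F p -> [/\ 0 <= z <= 1, y * z <= x & (1 - y) * z <= 1 - x].
Proof.
move=> coh; split; first exact: (coherent_cond_bounds i2 coh).
- have /coherentP /(_ setT (tnth [tuple 1; -1; - y])) := coh.
  case=> [|c [_ _]]; first by apply/set0Pn; exists i0.
  rewrite gain_triple /stakes !inE !(tnth_nth 0) /=.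
  by case: (_ <= A)%O; case: (_ <= C)%O => /=; nra.
have /coherentP /(_ setT (tnth [tuple -1; 1; y - 1])) := coh.
case=> [|c [_ _]]; first by apply/set0Pn; exists i0.
rewrite gain_triple /stakes !inE !(tnth_nth 0) /=.
by case: (_ <= A)%O; case: (_ <= C)%O => /=; nra.
Qed.

(** Where the bet is not void, some possible mass gives its gain the mean [0],
    so the gain is at most [0] at a point that this mass charges. *)
Lemma bounds_coherent_triple :
    0 <= y <= 1 -> 0 <= z -> y * z <= x -> (1 - y) * z <= 1 - x ->
  coherent F p.
Proof.
move=> /andP[y0 y1] z0 yz yz'; apply/coherentP => J s J0.
have AF := mem_family_consequent F i2; have CF := mem_family_consequent F i0.
(* [t] stands for the truth values of [A] and [C], in this order. *)
pose h (t : bool * bool) : R := stakes J s i0 * (t.2%:R - x) +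
  stakes J s i1 * t.1%:R * (t.2%:R - y) + stakes J s i2 * (t.1%:R - z).
suff [t tJ ht] : exists2 t, t.1 || (i0 \in J) || (i2 \in J) & h t <= 0.
  have [c cF [cA cC]] := constituent_realizes t.1 t.2 indep AF CF.
  exists c; split=> //; last by rewrite gain_triple cA cC.
  have below i : i \in J -> (c <= antecedent (tnth F i))%O ->
      (c <= \join_(i in J) antecedent (tnth F i))%O.
    by move=> iJ /le_trans; apply; apply: joins_sup.
  case: (boolP (i0 \in J)) => [|i0J]; first by move/below; apply; apply: lex1.
  case: (boolP (i2 \in J)) => [|i2J]; first by move/below; apply; apply: lex1.
  have i1J : i1 \in J.
    have /set0Pn[[[|[|[|//]]] lt3]] := J0; rewrite (bool_irrelevance lt3 isT) //.
      by move/(negP i0J).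
    by move/(negP i2J).
  apply: (below i1 i1J); move: tJ cA.
  by rewrite (negbTE i0J) (negbTE i2J) !orbF => ->.
have sum2 (f : bool * bool -> R) : \sum_t f t =
    f (true, true) + f (true, false) + f (false, true) + f (false, false).
  rewrite (eq_bigr (fun t => f (t.1, t.2))) => [|[a b] _ //].
  by rewrite -(pair_bigA _ (fun a b => f (a, b))) !big_bool /= addrA.
have [i02J|] := boolP ((i0 \in J) || (i2 \in J)).
  (* The bet is void nowhere, and the joint mass of [A] and [C] works. *)
  pose w (t : bool * bool) := if t.1 then (if t.2 then y else 1 - y) * z
    else if t.2 then x - y * z else 1 - x - (1 - y) * z.
  have [t _ ht] : exists2 t, 0 < w t & h t <= 0.
    apply: average_le0; first by case=> [[] []]; rewrite /w /=; nra.
      by rewrite sum2 /w /=; lra.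
    by rewrite sum2 /w /h /= le_eqVlt; apply/orP; left; apply/eqP; ring.
  by exists t => //; rewrite -orbA i02J orbT.
rewrite negb_or => /andP[/negbTE i0J /negbTE i2J].
(* The bet is on [C | A] alone: the joint mass may not charge [A], so it is
   replaced with the conditional one. *)
pose w (t : bool * bool) := if t.1 then (if t.2 then y else 1 - y) else 0.
have [t wt ht] : exists2 t, 0 < w t & h t <= 0.
  apply: average_le0; first by case=> [[] []]; rewrite /w /=; lra.
    by rewrite sum2 /w /=; lra.
  rewrite sum2 /w /h /stakes i0J i2J /= le_eqVlt.
  by apply/orP; left; apply/eqP; ring.
by exists t => //; move: wt; rewrite /w; case: t.1; rewrite ?ltxx.
Qed.

End Triple.
End Coherence.

Theorem theorem13 (R : realType) (d : Order.disp_t)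
    (B : ctbDistrLatticeType d) (A C : B)
    (indep : logically_independent [:: A; C]) (x y : R) :
  let evt := uncond_event (logically_independent_sure indep) in
  let C_given_A := CondEvent C (logically_independent_neq0 indep) in
  coherent [tuple evt C; C_given_A] [tuple x; y] ->
  forall z : R,
    coherent [tuple evt C; C_given_A; evt A] [tuple x; y; z] <->
    0 <= z <= (if x == y then 1
               else if x < y then x / y
               else (1 - x) / (1 - y)).
Proof.
move=> evt C_given_A coh z.
have /andP[x0 x1] : 0 <= x <= 1 := coherent_cond_bounds (@Ordinal 2 0 isT) coh.
have y01 : 0 <= y <= 1 := coherent_cond_bounds (@Ordinal 2 1 isT) coh.
have /andP[y0 y1] := y01.
split=> [/coherent_triple_bounds[/andP[z0 z1] yz yz'] | /andP[z0 zbound]].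
  by rewrite z0 /=; case: ltgtP => // xy; rewrite ler_pdivlMr ?subr_gt0; nra.
have [yz yz'] : y * z <= x /\ (1 - y) * z <= 1 - x.
  case: ltgtP zbound => [xy|yx|<-].
  - by rewrite ler_pdivlMr; last lra; move=> zx; split; nra.
  - by rewrite ler_pdivlMr; last lra; move=> zx; split; nra.
  - by move=> z1; split; nra.
exact: bounds_coherent_triple.
Qed.
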